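(* Let $G=(V,E)$ be a connected undirected graph on $n$ vertices with positive edge weights $w:E\to\mathbb{R}_+$, let $k\ge 2$ be an integer and let $\varepsilon>0$. Then there exists a $(2k-1)(1+\varepsilon)$-spanner $H$ of $G$ with $O(n^{1+1/k})$ edges and lightness \[ \frac{w(H)}{w(MST(G))}=O\!\left(n^{1/k}\cdot\Big(1+\frac{k}{\varepsilon^{1+1/k}\log k}\Big)\right), \] where the constants hidden in the $O(\cdot)$ notation are absolute (independent of $G,n,k,\varepsilon$).
   Context: For a weighted graph $G$, $d_G$ denotes its shortest-path distance. A subgraph $H=(V,E')$ of $G$ is a $t$-spanner if $d_H(u,v)\le t\cdot d_G(u,v)$ for all $u,v\in V$. The weight of a subgraph is $w(H)=\sum_{e\in E'}w(e)$, and $MST(G)$ denotes a minimum spanning tree of $G$; the lightness of $H$ is $w(H)/w(MST(G))$. *)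

(* Defs.v *)
From HB Require Import structures.
From mathcomp Require Import all_boot all_order all_algebra.
From mathcomp Require Import all_classical all_reals all_analysis.
Set Implicit Arguments. Unset Strict Implicit. Unset Printing Implicit Defensive.
Import Order.TTheory GRing.Theory Num.Theory.
Local Open Scope classical_set_scope.
Local Open Scope ring_scope.

(* A graph on the vertex set 'I_n is given by its set of (ordered) edge pairs;
   an gundirected simple graph is a symmetric irreflexive such set. *)
Definition graph (n : nat) := {set 'I_n * 'I_n}.

Definition adj n (E : graph n) : rel 'I_n := fun u v => (u, v) \in E.

Definition gundirected n (E : graph n) : Prop :=
  (forall u v, ((u, v) \in E) = ((v, u) \in E)) /\ (forall u, (u, u) \notin E).

Definition gconnected n (E : graph n) : Prop :=
  forall u v : 'I_n, connect (adj E) u v.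

(* weight of a walk u = x_0, x_1, ..., x_m = last u p (p = [:: x_1; ...; x_m]) *)
Definition walk_weight (R : realType) n (w : 'I_n -> 'I_n -> R) (u : 'I_n)
    (p : seq 'I_n) : R :=
  \sum_(e <- zip (u :: p) p) w e.1 e.2.

(* shortest-path distance d_E(u,v) (+oo if v is unreachable from u) *)
Definition gdist (R : realType) n (E : graph n) (w : 'I_n -> 'I_n -> R)
    (u v : 'I_n) : \bar R :=
  ereal_inf [set (walk_weight w u p)%:E |
             p in [set p : seq 'I_n | path (adj E) u p && (last u p == v)]].

Definition is_spanner (R : realType) n (E H : graph n) (w : 'I_n -> 'I_n -> R)
    (t : R) : Prop :=
  H \subset E /\ gundirected H /\
  forall u v : 'I_n, (gdist H w u v <= t%:E * gdist E w u v)%E.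

(* each gundirected edge {u,v} counted once, via the representative u < v *)
Definition num_edges n (H : graph n) : nat := #|[set p in H | (p.1 < p.2)%N]|.

Definition gweight (R : realType) n (w : 'I_n -> 'I_n -> R) (H : graph n) : R :=
  \sum_(p in H | (p.1 < p.2)%N) w p.1 p.2.

Definition gacyclic n (F : graph n) : Prop :=
  forall (u : 'I_n) (p : seq 'I_n),
    ~ [&& path (adj F) u p, uniq (u :: p), (1 < size p)%N & (last u p, u) \in F].

Definition spanning_tree n (E F : graph n) : Prop :=
  F \subset E /\ gundirected F /\ gconnected F /\ gacyclic F.

Definition is_MST (R : realType) n (E : graph n) (w : 'I_n -> 'I_n -> R)
    (T : graph n) : Prop :=
  spanning_tree E T /\
  forall F, spanning_tree E F -> gweight w T <= gweight w F.

(* Main.v *)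
Require Import Defs.
From HB Require Import structures.
From mathcomp Require Import all_boot all_order all_algebra.
From mathcomp Require Import all_classical all_reals all_analysis.
From mathcomp Require Import zify ring lra.
Set Implicit Arguments. Unset Strict Implicit. Unset Printing Implicit Defensive.
Import Order.TTheory GRing.Theory Num.Theory.
Local Open Scope ring_scope.

(** Let [X] be a spanning tree of minimum weight and put its vertices on a line of
length [L = 2 w(X)] by their first visit in a tree tour, so that tree distances are
at most distances on the line. Starting from [X], treat the remaining edges by
increasing weight and add an edge whenever its endpoints are still at distance more
than [(2k-1)(1+eps)] times its weight; let [A] be the set of added edges.

A closed sequence of at most [2k] distinct edges of [A] would let the last one be
bypassed by the others, so [A] has girth above [2k] and the Moore bound applies. This
survives gaps between consecutive edges that are bridged by the tree, as long as they
are small relative to [eps] times the weights. For the edges of weight in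
[[x, k x)], cut the line into pieces of length [eps x / 4] and replace an edge of
weight about [j x] by [j] copies, the [i]-th one having both ends shifted by [i]
pieces. A short cycle of copies gives a short closed sequence of distinct edges: if an
edge occurs twice, keep the part between two occurrences, whose extra gap is at most
about [eps k x / 2] because the weights at this scale differ by a factor of at most
[k]. The Moore bound for the copies is therefore a bound on the total weight at this
scale, and the bounds at the scales [x = k^i L / n] form a geometric series with
ratio [k^(-1/k)], whose sum is [O(k / log k)]. *)

(** * Non-backtracking walks and the Moore bound for multigraphs *)

Section Moore.

Local Open Scope nat_scope.

Variables (I V : finType) (a b : I -> V).

(** Indexing edges by [I] admits the loops and parallel edges that copies may produce; a dart is an
    edge with a direction. *)
Definition dart_src (d : I * bool) := if d.2 then a d.1 else b d.1.
Definition dart_tgt (d : I * bool) := if d.2 then b d.1 else a d.1.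
Definition dart_inv (d : I * bool) := (d.1, ~~ d.2).
Definition nonbacktracking : rel (I * bool) :=
  fun d d' => (dart_tgt d == dart_src d') && (d' != dart_inv d).

Lemma dart_invK : involutive dart_inv.
Proof. by case=> e c; rewrite /dart_inv /= negbK. Qed.

Lemma dart_src_inv d : dart_src (dart_inv d) = dart_tgt d.
Proof. by case: d => e []. Qed.

Lemma dart_tgt_inv d : dart_tgt (dart_inv d) = dart_src d.
Proof. by case: d => e []. Qed.

Lemma nonbacktracking_inv d d' :
  nonbacktracking (dart_inv d') (dart_inv d) = nonbacktracking d d'.
Proof.
rewrite /nonbacktracking dart_tgt_inv dart_src_inv dart_invK.
by rewrite (eq_sym d') (eq_sym (dart_tgt d)).
Qed.

Lemma path_nonbacktracking_rev x p :
  path nonbacktracking x p ->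
  path nonbacktracking (dart_inv (last x p)) (rev (map dart_inv (belast x p))).
Proof.
move=> xp; rewrite -(last_map dart_inv) -belast_map rev_path path_map.
by rewrite (eq_path (e' := nonbacktracking)) // => d d'; rewrite /= nonbacktracking_inv.
Qed.

(** Strip common final darts until the last ones differ. Then the first walk followed by the
    reversed second one backtracks neither at the far end nor, as [x != y], at the common source. *)
Lemma diverging_walks_cycle x p y q :
  x != y -> dart_src x = dart_src y -> size p = size q ->
  path nonbacktracking x p -> path nonbacktracking y q ->
  dart_tgt (last x p) = dart_tgt (last y q) ->
  exists c, [/\ cycle nonbacktracking c, c != [::] & size c <= 2 * (size p).+1].
Proof.
move=> neq_xy eq_src.
have [m] := ubnP (size p); elim: m p q => // m IHm p q.
move=> le_pm eq_size xp yq eq_tgt.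
have [eq_last|neq_last] := eqVneq (last x p) (last y q).
  case/lastP: p => [|p u] in le_pm eq_size xp eq_tgt eq_last *.
    by case: q eq_size eq_last {eq_tgt yq} => // _ /= /eqP; rewrite (negPf neq_xy).
  case/lastP: q => [|q v] in eq_size yq eq_tgt eq_last *.
    by rewrite size_rcons in eq_size.
  rewrite !last_rcons in eq_last; subst v.
  move: eq_size xp yq; rewrite !size_rcons !rcons_path => -[eq_size].
  case/andP=> xp /andP[/eqP xu _] /andP[yq /andP[/eqP yu _]].
  rewrite size_rcons in le_pm.
  have [||c [cyc c0 sz]] := IHm p q _ eq_size xp yq _; [lia | by rewrite xu yu |].
  by exists c; split=> //; lia.
exists (x :: p ++ rev (map dart_inv (y :: q))); split=> //; last first.
  by rewrite /= size_cat size_rev /= size_map; lia.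
rewrite (lastI y q) map_rcons rev_rcons /cycle rcons_cat cat_path xp /=.
rewrite {1}/nonbacktracking dart_src_inv eq_tgt eqxx (can_eq dart_invK) eq_sym neq_last /=.
rewrite rcons_path path_nonbacktracking_rev //=.
have -> : last (dart_inv (last y q)) (rev [seq dart_inv i | i <- belast y q]) = dart_inv y.
  by case: q {eq_size yq eq_tgt neq_last} => //= z q; rewrite rev_cons last_rcons.
by rewrite /nonbacktracking dart_tgt_inv dart_invK eq_src eqxx.
Qed.

Variable D : nat.

Definition induced_edges (U : {set V}) := [set e | (a e \in U) && (b e \in U)].

(* A vertex set minimal among those spanning more than [D] edges per vertex has
   minimum degree above [D]. *)
Lemma dense_core : D * #|V| < #|I| ->
  exists2 U : {set V}, U != finset.set0 &
    forall v, v \in U -> D < #|[set d | (dart_src d == v) && (dart_tgt d \in U)]|.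
Proof.
move=> dense.
have exU : D * #|(finset.setTfor V)| < #|induced_edges (finset.setTfor V)|.
  rewrite cardsT [induced_edges _](_ : _ = finset.setTfor I) ?cardsT //.
  by apply/finset.setP=> e; rewrite !inE.
have [U /minsetP[/= densU minU] _] :=
  minset_exists (P := fun U : {set V} => D * #|U| < #|induced_edges U|) exU.
exists U.
  apply: contraTneq densU => ->; rewrite cards0 muln0 -leqNgt leqn0 cards_eq0.
  by apply/eqP/finset.setP=> e; rewrite !inE.
move=> v vU; set S := [set d | _].
have sparse : #|induced_edges (U :\ v)| <= D * #|U :\ v|.
  rewrite leqNgt; apply/negP=> /minU /(_ (finset.subD1set _ _)) /finset.setP /(_ v).
  by rewrite !inE eqxx vU.
have sub : induced_edges U :\: induced_edges (U :\ v) \subset [set d.1 | d in S].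
  apply/fintype.subsetP=> e; rewrite !inE => /andP[nv /andP[aU bU]].
  move: nv; rewrite aU bU !andbT negb_and !negbK => /orP[] /eqP ev; apply/imsetP.
    by exists (e, true); rewrite ?inE /dart_src /dart_tgt /= ?ev ?eqxx.
  by exists (e, false); rewrite ?inE /dart_src /dart_tgt /= ?ev ?eqxx.
have := leq_trans (subset_leq_card sub) (leq_imset_card _ _); rewrite cardsD.
have := subset_leq_card (finset.subsetIr (induced_edges U) (induced_edges (U :\ v))).
move: densU sparse; rewrite (cardsD1 v U) vU mulnDr muln1 => {sub}.
move: #|_ :&: _| #|induced_edges U| #|induced_edges (U :\ v)| #|S| => x y z t.
lia.
Qed.

(** In a dense core every dart has at least [D] non-backtracking continuations, hence [D ^ k] walks
    of [k] further darts. Two of them ending at one vertex would diverge somewhere and form a short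
    cycle, so there would be at least [D ^ k] vertices. *)
Lemma moore_bound k :
  (forall c, cycle nonbacktracking c -> size c <= 2 * k -> c = [::]) ->
  #|V| < D ^ k -> #|I| <= D * #|V|.
Proof.
move=> girth big; rewrite leqNgt; apply/negP=> /dense_core[U /set0Pn[v0 v0U] mindeg].
pose S d := [set d' | nonbacktracking d d' && (dart_tgt d' \in U)].
have cardS d : dart_tgt d \in U -> D <= #|S d|.
  move=> /mindeg; rewrite (cardsD1 (dart_inv d)) => lt.
  suff -> : S d =
    [set d' | (dart_src d' == dart_tgt d) && (dart_tgt d' \in U)] :\ dart_inv d by lia.
  by apply/finset.setP=> d'; rewrite !inE /nonbacktracking eq_sym andbCA andbA.
pose next d (i : 'I_D) := nth d (enum (S d)) i.
have nextS d i : dart_tgt d \in U -> next d i \in S d.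
  by move=> dU; rewrite -mem_enum mem_nth // -cardE (leq_trans _ (cardS _ dU)).
have next_inj d : dart_tgt d \in U -> injective (next d).
  move=> dU i j /eqP; rewrite nth_uniq ?enum_uniq -?cardE ?(leq_trans _ (cardS _ dU)) //.
  by move/eqP/val_inj.
have [d0 d0U] : exists d, dart_tgt d \in U.
  have := mindeg _ v0U; case: (set_0Vmem [set d | (dart_src d == v0) && (dart_tgt d \in U)]).
    by move=> ->; rewrite cards0.
  by case=> d; rewrite inE => /andP[_ dU] _; exists d.
pose walk := fix walk d (l : seq 'I_D) :=
  if l is i :: l' then next d i :: walk (next d i) l' else [::].
have size_walk d l : size (walk d l) = size l.
  by elim: l d => //= i l IHl d; rewrite IHl.
have walkU d l : dart_tgt d \in U -> path nonbacktracking d (walk d l).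
  elim: l d => //= i l IHl d dU; have := nextS d i dU; rewrite inE => /andP[-> iU].
  exact: IHl.
have walk_eq l l' d : dart_tgt d \in U -> size l = size l' -> size l <= k ->
    dart_tgt (last d (walk d l)) = dart_tgt (last d (walk d l')) -> l = l'.
  elim: l l' d => [|i l IHl] [|i' l'] d //= dU [eq_size] le_k eq_tgt.
  have [eqi|neqi] := eqVneq i i'.
    subst i'; congr (_ :: _); apply: IHl eq_tgt; rewrite ?(ltnW le_k) //.
    by have := nextS d i dU; rewrite inE => /andP[].
  have := nextS d i dU; have := nextS d i' dU; rewrite !inE.
  move=> /andP[/andP[/eqP s' _] iU'] /andP[/andP[/eqP s _] iU].
  have [||||||c [cyc c0 szc]] := @diverging_walks_cycle (next d i) (walk (next d i) l)
     (next d i') (walk (next d i') l').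
  - by apply: contra_neq neqi => /next_inj ->.
  - by rewrite -s -s'.
  - by rewrite !size_walk.
  - exact: walkU.
  - exact: walkU.
  - by [].
  rewrite size_walk in szc; move: c0; rewrite (girth c) //; lia.
suff inj : injective (fun l : k.-tuple 'I_D => dart_tgt (last d0 (walk d0 l))).
  by have := leq_card _ inj; rewrite card_tuple card_ord; lia.
by move=> l l' /walk_eq H; apply/val_inj/H; rewrite // !size_tuple.
Qed.

End Moore.

(** * Distances as walk budgets, and the greedy construction *)

Section Walks.

Variables (R : realType) (n : nat) (w : 'I_n -> 'I_n -> R).
Hypothesis w_sym : forall u v, w u v = w v u.
Implicit Types (X Y A : {set 'I_n * 'I_n}) (u v x : 'I_n) (c : R).

Definition ew (e : 'I_n * 'I_n) : R := w e.1 e.2.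

Definition symg X : graph n := [set p | (p \in X) || ((p.2, p.1) \in X)].

(** A walk serves as witness for a distance of at most [c], which spares the infimum and the
    infinite values of [gdist]. *)
Definition reach X u v c := exists p,
  [/\ path (adj (symg X)) u p, last u p = v & walk_weight w u p <= c].

Lemma walk_weight_nil u : walk_weight w u [::] = 0.
Proof. by rewrite /walk_weight big_nil. Qed.

Lemma walk_weight_cons u v p : walk_weight w u (v :: p) = w u v + walk_weight w v p.
Proof. by rewrite /walk_weight /= big_cons. Qed.

Lemma walk_weight_cat u p q :
  walk_weight w u (p ++ q) = walk_weight w u p + walk_weight w (last u p) q.
Proof.
elim: p u => [|v p IHp] u; first by rewrite walk_weight_nil add0r.
by rewrite cat_cons !walk_weight_cons IHp addrA.
Qed.

Lemma walk_weight_ge0 (E : graph n) u p :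
  (forall x y, (x, y) \in E -> 0 <= w x y) -> path (adj E) u p ->
  0 <= walk_weight w u p.
Proof.
move=> w0; elim: p u => [|v p IHp] u; first by rewrite walk_weight_nil.
by move=> /= /andP[uv vp]; rewrite walk_weight_cons addr_ge0 ?w0 ?IHp.
Qed.

Lemma adj_symgC X u v : adj (symg X) u v = adj (symg X) v u.
Proof. by rewrite /adj !inE /= orbC. Qed.

Lemma reach_refl X u c : 0 <= c -> reach X u u c.
Proof. by exists [::]; rewrite walk_weight_nil. Qed.

Lemma reach_le X u v c c' : c <= c' -> reach X u v c -> reach X u v c'.
Proof. by move=> le_c [p [? ? le_p]]; exists p; split=> //; apply: le_trans le_c. Qed.

Lemma reach_sub X Y u v c : X \subset Y -> reach X u v c -> reach Y u v c.
Proof.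
move=> /fintype.subsetP XY [p [up pv le_p]]; exists p; split=> //.
apply: sub_path up => x y; rewrite /adj !inE => /orP[] /XY -> //.
by rewrite orbT.
Qed.

Lemma reach_trans X u v x c c' : reach X u v c -> reach X v x c' -> reach X u x (c + c').
Proof.
move=> [p [up pv le_p]] [q [vq qx le_q]]; exists (p ++ q).
by rewrite cat_path last_cat walk_weight_cat pv up vq lerD.
Qed.

Lemma reach_adj X u v : adj (symg X) u v -> reach X u v (w u v).
Proof.
move=> uv; exists [:: v]; split=> //=; first by rewrite uv.
by rewrite walk_weight_cons walk_weight_nil addr0.
Qed.

Lemma reach_sym X u v c : reach X u v c -> reach X v u c.
Proof.
move=> [p [up <- le_p]]; apply: reach_le le_p _.
elim: p u up => [|x p IHp] u /=; first by rewrite walk_weight_nil => _; apply: reach_refl.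
move=> /andP[ux xp]; rewrite walk_weight_cons addrC.
apply: reach_trans (IHp _ xp) _; rewrite w_sym; apply: reach_adj.
by rewrite adj_symgC.
Qed.

Lemma gundirected_symg X : (forall e, e \in X -> (e.1 < e.2)%N) -> gundirected (symg X).
Proof.
move=> X_lt; split=> [u v|u]; first by rewrite !inE /= orbC.
by rewrite !inE /= orbb; apply/negP=> /X_lt; rewrite ltnn.
Qed.

Lemma symg_lt X : (forall e, e \in X -> (e.1 < e.2)%N) ->
  forall e, ((e \in symg X) && (e.1 < e.2)%N) = (e \in X).
Proof.
move=> X_lt e; rewrite inE; apply/andP/idP => [[/orP[] // /X_lt /= lt1 lt2]|eX].
  by move: (ltn_trans lt1 lt2); rewrite ltnn.
by rewrite eX X_lt.
Qed.

Lemma gweight_symg X : (forall e, e \in X -> (e.1 < e.2)%N) ->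
  gweight w (symg X) = \sum_(e in X) ew e.
Proof. by move=> X_lt; apply: eq_bigl => e; rewrite symg_lt. Qed.

Lemma num_edges_symg X : (forall e, e \in X -> (e.1 < e.2)%N) ->
  num_edges (symg X) = #|X|.
Proof. by move=> X_lt; apply: eq_card => e; rewrite inE symg_lt. Qed.

Lemma greedy_exists X t (s : seq ('I_n * 'I_n)) : uniq s ->
  {in s, forall e, ew e <= t * ew e} ->
  exists A, [/\ {subset A <= s},
    {in A, forall f, ~ reach (X :|: [set e in A | index e s < index f s]%N)
                         f.1 f.2 (t * ew f)} &
    {in s, forall e, reach (X :|: A) e.1 e.2 (t * ew e)}].
Proof.
elim/last_ind: s => [|s f IHs]; first by exists finset.set0; split=> // e; rewrite inE.
rewrite rcons_uniq => /andP[fs s_uniq] le_t.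
have sub_rcons e : e \in s -> e \in rcons s f by rewrite mem_rcons inE => ->; rewrite orbT.
have [//|e /sub_rcons/le_t //|A [sAs noA spanA]] := IHs.
have idx e : e \in s -> index e (rcons s f) = index e s.
  by move=> es; rewrite -cats1 index_cat es.
have idxf : index f (rcons s f) = size s.
  by rewrite -cats1 index_cat (negPf fs) /= eqxx addn0.
have [yes|no] := pselect (reach (X :|: A) f.1 f.2 (t * ew f)).
  exists A; split=> [e /sAs/sub_rcons //|e eA|e].
    rewrite [finset _](_ : _ = [set e' in A | index e' s < index e s]%N); first exact: noA.
    apply/setP=> e'; rewrite !inE; apply: andb_id2l => e'A.
    by rewrite !idx // sAs.
  by rewrite mem_rcons inE => /orP[/eqP -> //|/spanA].
exists (f |: A); split=> [e|e|e].
- by rewrite mem_rcons !inE => /orP[-> //|/sAs ->]; rewrite orbT.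
- rewrite !inE => /orP[/eqP ->|eA].
    apply: contra_not no; apply: reach_sub; apply/fintype.subsetP=> e'; rewrite !inE.
    case/orP=> [-> //|/andP[/orP[/eqP ->|->]]]; last by rewrite orbT.
    by rewrite ltnn.
  rewrite [finset _](_ : _ = [set e' in A | index e' s < index e s]%N); first exact: noA.
  apply/setP=> e'; rewrite !inE; have [->|neq] := eqVneq e' f.
    rewrite idxf (idx e) ?sAs //= (contraNF (@sAs f)) // ltnNge.
    by rewrite ltnW // index_mem sAs.
  by apply: andb_id2l => e'A; rewrite !idx // sAs.
- rewrite mem_rcons inE => /orP[/eqP ->|/spanA]; last first.
    by apply: reach_sub; apply: finset.setUS; apply: finset.subsetUr.
  apply: reach_le (le_t f _) (reach_adj _); first by rewrite mem_rcons inE eqxx.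
  by rewrite /adj !inE -surjective_pairing eqxx /= orbT.
Qed.

End Walks.

(** * Laying out a spanning tree on a line by a tour *)

Section Tour.

Variables (R : realType) (n : nat) (w : 'I_n -> 'I_n -> R).
Hypothesis w_sym : forall u v, w u v = w v u.
Implicit Types (X Y A : {set 'I_n * 'I_n}) (u v x : 'I_n) (c : R).

Definition upper (E : graph n) : {set 'I_n * 'I_n} := [set e in E | (e.1 < e.2)%N].

Lemma crossing_edge (E : graph n) (S : {set 'I_n}) r z :
  gundirected E -> gconnected E -> r \in S -> z \notin S ->
  exists u v, [/\ u \in S, v \notin S & adj E u v].
Proof.
move=> [E_sym _] E_conn rS; apply: contraNP => no.
have clS : fingraph.closed (adj E) (mem S).
  have half u v : adj E u v -> u \in S -> v \in S.
    move=> uv uS; apply: contrapT => /negP vS; apply: no.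
    by exists u, v.
  by move=> u v uv; apply/idP/idP; apply: half; rewrite // /adj E_sym.
by rewrite -(closed_connect clS (E_conn r z)).
Qed.

(** An edge from [u] to [v] leaving the visited set is added, and the detour [v], [u] is inserted
    after a visit of [u]; each edge thus counts twice in the weight of the tour. *)
Lemma partial_tour (E : graph n) r m :
  gundirected E -> gconnected E -> (m < n)%N ->
  exists X p, [/\ X \subset upper E, path (adj (symg X)) r p,
    walk_weight w r p = 2 * \sum_(e in X) ew w e,
    (forall e, e \in X -> (e.1 \in r :: p) && (e.2 \in r :: p)) &
    #|X| = m /\ #|[set v in r :: p]| = m.+1].
Proof.
move=> E_und E_conn; elim: m => [_|m IHm lt_mn].
  exists finset.set0, [::]; split=> //.
  - exact: finset.sub0set.
  - by rewrite walk_weight_nil big1 ?mulr0 // => e; rewrite inE.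
  - by move=> e; rewrite inE.
  - split; first by rewrite cards0.
    rewrite -(cards1 r); apply: eq_card => v; by rewrite !inE.
have [X [p [sXE rp wp Xp [cX cp]]]] := IHm (ltnW lt_mn).
have [z zS] : exists z, z \notin [set v in r :: p].
  apply: contraPP lt_mn => /forallNP allS.
  apply/negP; rewrite -leqNgt -cp (_ : [set v in r :: p] = finset.setT) ?cardsT ?card_ord //.
  by apply/finset.setP=> v; rewrite [RHS]inE; apply/negbNE/negP/allS.
have [|u [v]] := crossing_edge E_und E_conn _ zS (r := r).
  by rewrite !inE eqxx.
rewrite !inE => -[uS vS uv].
pose f := if (u < v)%N then (u, v) else (v, u).
have neq_uv : u != v.
  by apply: contraNneq vS => <-.
have fE : f \in upper E.
  rewrite /f; case: ltngtP => [lt_uv|lt_vu|/val_inj/eqP eq_uv]; last by rewrite eq_uv in neq_uv.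
    by rewrite inE lt_uv andbT.
  by rewrite inE lt_vu andbT -E_und.1.
have ewf : ew w f = w u v by rewrite /f /ew; case: ifP.
have fX : f \notin X.
  apply: contra vS => /Xp; rewrite /f; case: ifP => _ /= /andP[]; by rewrite !inE.
have sX : forall x y, adj (symg X) x y -> adj (symg (f |: X)) x y.
  by move=> x y; rewrite /adj !inE => /orP[] ->; rewrite !orbT.
have uvX : adj (symg (f |: X)) u v.
  by rewrite /adj !inE /f /=; case: ifP => _; rewrite eqxx ?orbT.
have uP : u \in r :: p by rewrite inE.
case/splitPl: {p uS zS} uP vS rp wp Xp cp => p1 p2 lu vS rp wp Xp cp.
exists (f |: X), (p1 ++ [:: v, u & p2]); split.
- by rewrite finset.subUset finset.sub1set fE.
- move: rp; rewrite !cat_path lu /= => /andP[rp1 up2].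
  by rewrite (sub_path sX rp1) (sub_path sX up2) uvX adj_symgC uvX.
- rewrite walk_weight_cat lu !walk_weight_cons big_setU1 //= mulrDr -wp.
  by rewrite walk_weight_cat lu ewf (w_sym v u); lra.
- move=> e; rewrite !inE => /orP[/eqP ->|/Xp]; rewrite /f.
    have : u \in r :: p1 by rewrite -lu mem_last.
    rewrite !inE => up1.
    by case: ifP => _ /=; rewrite ?(inE, mem_cat) !orbA up1 !eqxx !orbT.
  rewrite ?(inE, mem_cat) => /andP[e1 e2].
  by apply/andP; split; [move: e1|move: e2] => /or3P[] ->; rewrite ?orbT.
- rewrite cardsU1 fX cX; split=> //.
  rewrite -cp (_ : [set x in r :: p1 ++ [:: v, u & p2]] = v |: [set x in r :: p1 ++ p2]).
    by rewrite cardsU1 !inE vS.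
  have : u \in r :: p1 by rewrite -lu mem_last.
  rewrite inE => up1; apply/finset.setP=> x; rewrite !inE !mem_cat !inE.
  have [->|_] := eqVneq x v; first by rewrite !orbT.
  by have [->|_] := eqVneq x u; rewrite //= !orbA up1.
Qed.

(** Prefix weights of the tour become positions on the line; the part of the tour between two visits
    realizes their difference. *)
Lemma walk_segment X r p i j : path (adj (symg X)) r p -> (i <= j <= size p)%N ->
  reach w X (nth r (r :: p) i) (nth r (r :: p) j)
    (walk_weight w r (take j p) - walk_weight w r (take i p)).
Proof.
move=> rp /andP[le_ij le_jp].
have last_take m : (m <= size p)%N -> last r (take m p) = nth r (r :: p) m.
  by case: m => [|m] lt_m; rewrite ?take0 // (take_nth r) // last_rcons.
have split_j : take j p = take i p ++ drop i (take j p).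
  by rewrite -{1}(cat_take_drop i (take j p)) take_takel.
move: (drop i (take j p)) split_j => d split_j; exists d; split.
- move: rp; rewrite -{1}(cat_take_drop j p) cat_path => /andP[+ _].
  by rewrite split_j cat_path last_take ?(leq_trans le_ij) // => /andP[].
- by rewrite -!last_take ?(leq_trans le_ij) // split_j last_cat.
- by rewrite split_j walk_weight_cat last_take ?(leq_trans le_ij) // addrAC subrr add0r.
Qed.

(* Vertices are placed on the real line at their first visit by a depth-first tour. *)
Lemma tree_line (E : graph n) : (0 < n)%N ->
  gundirected E -> gconnected E -> (forall u v, (u, v) \in E -> 0 <= w u v) ->
  exists X (pos : 'I_n -> R), [/\ X \subset upper E, (#|X| <= n)%N,
    forall u v, reach w X u v `|pos u - pos v| &
    forall u, 0 <= pos u <= 2 * \sum_(e in X) ew w e].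
Proof.
move=> n_gt0 E_und E_conn w_ge0; pose r := Ordinal n_gt0.
have [|X [p [sXE rp wp _ [cX cp]]]] := @partial_tour E r n.-1 E_und E_conn.
  by rewrite prednK.
rewrite prednK // in cp.
have allp v : v \in r :: p.
  have : [set v in r :: p] = finset.setT.
    by apply/eqP; rewrite eqEcard finset.subsetT cp cardsT card_ord leqnn.
  by move=> /finset.setP/(_ v); rewrite !inE.
have idx v : (index v (r :: p) <= size p)%N by rewrite -ltnS -/(size (r :: p)) index_mem.
have w0 u v : (u, v) \in symg X -> 0 <= w u v.
  rewrite inE => /orP[] /(fintype.subsetP sXE); rewrite inE => /andP[uvE _].
    exact: w_ge0.
  by rewrite w_sym w_ge0.
pose pos v := walk_weight w r (take (index v (r :: p)) p).
exists X, pos; split=> //.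
- by rewrite cX leq_pred.
- move=> u v; wlog le_uv : u v / (index u (r :: p) <= index v (r :: p))%N.
    move=> H; case/orP: (leq_total (index u (r :: p)) (index v (r :: p))) => /H //.
    by move=> /(reach_sym w_sym); rewrite distrC.
  have /(walk_segment rp) : (index u (r :: p) <= index v (r :: p) <= size p)%N.
    by rewrite le_uv idx.
  rewrite !nth_index //; apply: reach_le.
  by rewrite distrC ler_norm.
- move=> u; rewrite -wp /pos; set i := index _ _.
  move: rp; rewrite -{1}(cat_take_drop i p) cat_path => /andP[rp1 rp2].
  rewrite (walk_weight_ge0 w0 rp1) /=.
  rewrite -[in leRHS](cat_take_drop i p) walk_weight_cat lerDl.
  exact: walk_weight_ge0 w0 rp2.
Qed.

End Tour.

(** Searching the tail first yields an innermost repetition: no value repeats from [x] up to just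
    before [y]. *)
Lemma nonuniq_split (T T' : eqType) (f : T -> T') (s : seq T) : ~~ uniq (map f s) ->
  exists s1 x p y s2, [/\ s = s1 ++ x :: p ++ y :: s2, f x = f y & uniq (map f (x :: p))].
Proof.
elim: s => //= z s IHs; rewrite negb_and.
have [s_uniq|/IHs[s1 [x [p [y [s2 [-> fxy p_uniq]]]]]] _] := boolP (uniq (map f s)); last first.
  by exists (z :: s1), x, p, y, s2.
rewrite orbF negbK => /mapP[y ys fzy]; exists [::], z.
case/splitPr: ys s_uniq => p s2; rewrite map_cat cat_uniq => /and3P[p_uniq dis _].
exists p, y, s2; split=> //=; rewrite p_uniq andbT fzy.
by move: dis; apply: contra => yp; rewrite /= yp.
Qed.

Lemma argmax_seq (T : eqType) (f : T -> nat) (s : seq T) : s != [::] ->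
  exists2 x, x \in s & {in s, forall y, (f y <= f x)%N}.
Proof.
elim: s => // z s IHs _; have [s0|/IHs[x xs max_x]] := eqVneq s [::].
  by exists z; rewrite ?mem_head // s0 => y; rewrite inE => /eqP ->.
case: (leqP (f x) (f z)) => [le_xz|/ltnW le_zx].
  exists z; rewrite ?mem_head // => y; rewrite inE => /orP[/eqP -> //|/max_x le_yx].
  exact: leq_trans le_xz.
by exists x; rewrite ?inE ?xs ?orbT // => y; rewrite inE => /orP[/eqP -> //|/max_x].
Qed.

(** * Girth of the greedy edges and of their shifted copies *)

Section Girth.

Variables (R : realType) (n : nat) (w : 'I_n -> 'I_n -> R).
Hypothesis w_sym : forall u v, w u v = w v u.
Variables (X A : {set 'I_n * 'I_n}) (rank : 'I_n * 'I_n -> nat) (k : nat) (eps : R).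
Hypothesis k_gt0 : (0 < k)%N.
Hypothesis A_gt0 : {in A, forall e, 0 < ew w e}.
Hypothesis rank_inj : {in A &, injective rank}.
Hypothesis rank_mono : {in A &, forall e f, (rank e < rank f)%N -> ew w e <= ew w f}.
Hypothesis greedy : {in A, forall f,
  ~ reach w (X :|: [set e in A | (rank e < rank f)%N]) f.1 f.2
      ((2 * k - 1)%:R * (1 + eps) * ew w f)}.

(* Every [i : I] is a copy of the edge [orig i]; its ends [a i], [b i] need not be those
   of the edge, but copies with a common end come from edges that the tree [X] links at
   a small cost. *)
Variables (I V : finType) (orig : I -> 'I_n * 'I_n) (a b : I -> V) (g : R).
Hypothesis origA : forall i, orig i \in A.
Hypothesis g_ge0 : 0 <= g.
Hypothesis g_le : 4 * k%:R * g <= (2 * k - 1)%:R * eps.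

Let dart := (I * bool)%type.
Let wt (d : dart) := ew w (orig d.1).
Let tail (d : dart) := if d.2 then (orig d.1).1 else (orig d.1).2.
Let head (d : dart) := if d.2 then (orig d.1).2 else (orig d.1).1.
Let src := dart_src a b.
Let tgt := dart_tgt a b.

Hypothesis gap : forall d d' : dart, src d = src d' ->
  reach w X (tail d) (tail d') (g * Num.max (wt d) (wt d')).
(** The factor [g] on both sides leaves the weights unconstrained when [g = 0]. *)
Hypothesis ratio : forall d d' : dart, g * wt d <= g * k%:R * wt d'.
(** This turns two consecutive copies of one edge in opposite directions into a backtracking
    step. *)
Hypothesis copies : forall d d' : dart,
  src d = src d' -> orig d.1 = orig d'.1 -> d.2 = d'.2 -> d = d'.

Let linked : rel dart := fun d d' => tgt d == src d'.

Let tail_inv d : tail (dart_inv d) = head d.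
Proof. by case: d => i []. Qed.

Let gap_linked d d' : linked d d' ->
  reach w X (head d) (tail d') (g * Num.max (wt d) (wt d')).
Proof.
by move=> /eqP dd'; rewrite -tail_inv; apply: gap; rewrite /src dart_src_inv.
Qed.

Lemma reach_dart (Y : {set 'I_n * 'I_n}) (d : dart) :
  orig d.1 \in Y -> reach w Y (tail d) (head d) (wt d).
Proof.
case: d => i [] /= iY; rewrite /tail /head /wt /ew /=; last rewrite w_sym.
  by apply: reach_adj; rewrite /adj !inE -surjective_pairing iY.
by apply: reach_adj; rewrite /adj !inE -surjective_pairing iY orbT.
Qed.

(** Each dart of [s] costs one gap and one edge. The walk starts at the head of [f], the edge to be
    bypassed, which may lie outside [Y]. *)
Lemma reach_after (Y : {set 'I_n * 'I_n}) W f s :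
  X \subset Y -> path linked f s -> wt f <= W ->
  {in s, forall d, (orig d.1 \in Y) && (wt d <= W)} ->
  reach w Y (head f) (head (last f s)) ((size s)%:R * ((1 + g) * W)).
Proof.
move=> sXY; elim: s f => [|z s IHs] f /=; first by move=> *; apply: reach_refl; rewrite mul0r.
move=> /andP[fz zs] fW sW; have /andP[zY zW] := sW z (mem_head _ _).
have sW' : {in s, forall d, (orig d.1 \in Y) && (wt d <= W)}.
  by move=> d ds; apply: sW; rewrite inE ds orbT.
rewrite -natr1 mulrDl mul1r addrC; apply: reach_trans _ (IHs z zs zW sW').
have := reach_trans (reach_sub sXY (gap_linked fz)) (reach_dart zY).
apply: reach_le; rewrite mulrDl mul1r addrC lerD // ler_wpM2l //.
by rewrite ge_max fW.
Qed.

Lemma reach_before (Y : {set 'I_n * 'I_n}) W f z s :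
  X \subset Y -> path linked z (rcons s f) -> wt f <= W ->
  {in z :: s, forall d, (orig d.1 \in Y) && (wt d <= W)} ->
  reach w Y (tail z) (tail f) ((size s).+1%:R * ((1 + g) * W)).
Proof.
move=> sXY; elim: s z => [|y s IHs] z /= + fW sW;
  have /andP[zY zW] := sW z (mem_head _ _) => /andP[zy ys].
  have := reach_trans (reach_dart zY) (reach_sub sXY (gap_linked zy)).
  apply: reach_le; rewrite mul1r mulrDl mul1r lerD // ler_wpM2l //.
  by rewrite ge_max fW andbT.
have sW' : {in y :: s, forall d, (orig d.1 \in Y) && (wt d <= W)}.
  by move=> d ds; apply: sW; rewrite inE ds orbT.
rewrite -[(size s).+2%:R]natr1 mulrDl mul1r addrC; apply: reach_trans _ (IHs y ys fW sW').
have := reach_trans (reach_dart zY) (reach_sub sXY (gap_linked zy)).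
apply: reach_le; rewrite mulrDl mul1r lerD // ler_wpM2l //.
by rewrite ge_max zW; case/andP: (sW' y (mem_head _ _)).
Qed.

(* The greedy step that inserted the last edge of the sequence saw all the others,
   which together with the gaps connect its endpoints too cheaply. *)
Lemma no_short_closed_sequence z s c : path linked z s -> (size s < 2 * k)%N ->
  uniq (map (fun d => orig d.1) (z :: s)) ->
  reach w X (head (last z s)) (tail z) c ->
  {in z :: s, forall d, c <= 2 * k%:R * g * wt d} -> False.
Proof.
move=> zs size_s zs_uniq closing c_le.
have [//|f fzs max_f] := @argmax_seq _ (fun d : dart => rank (orig d.1)) (z :: s).
pose Y := X :|: [set e in A | (rank e < rank (orig f.1))%N].
have sXY : X \subset Y by exact: finset.subsetUl.
have wf : 0 < wt f by apply: A_gt0.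
have [s1 [s2 def_zs]] : exists s1 s2, z :: s = s1 ++ f :: s2.
  by case/splitPr: fzs => s1 s2; exists s1, s2.
have others : {in s1 ++ s2, forall d, (orig d.1 \in Y) && (wt d <= wt f)}.
  move=> d ds; suff lt_df : (rank (orig d.1) < rank (orig f.1))%N.
    by rewrite !inE origA lt_df orbT /= rank_mono.
  rewrite ltn_neqAle max_f ?andbT; last first.
    by move: ds; rewrite def_zs !mem_cat inE => /orP[] ->; rewrite ?orbT.
  apply: contraTneq zs_uniq => /(rank_inj (origA _) (origA _)) eq_df.
  rewrite def_zs map_cat /= -cat1s uniq_catCA /= -map_cat negb_and -eq_df negbK.
  by rewrite (map_f (fun d : dart => orig d.1)).
have s2Y : {in s2, forall d, (orig d.1 \in Y) && (wt d <= wt f)}.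
  by move=> d ds; apply: others; rewrite mem_cat ds orbT.
have s1Y : {in s1, forall d, (orig d.1 \in Y) && (wt d <= wt f)}.
  by move=> d ds; apply: others; rewrite mem_cat ds.
have : reach w Y (head f) (tail f) ((size s)%:R * ((1 + g) * wt f) + c).
  case: s1 def_zs s1Y {others} => [|z1 s1] [? def_s] s1Y; subst.
    by apply: reach_trans (reach_sub sXY closing); apply: reach_after.
  move: zs closing; rewrite last_cat -cat_rcons cat_path last_rcons /= => /andP[zf fs2] closing.
  have := reach_trans (reach_trans (reach_after sXY fs2 (lexx _) s2Y) (reach_sub sXY closing))
    (reach_before sXY zf (lexx _) s1Y).
  apply: reach_le; rewrite size_cat /= addrAC -mulrDl -natrD lerD2r.
  by rewrite addnC size_rcons.
have size_le : (size s)%:R <= (2 * k - 1)%:R :> R by rewrite ler_nat; lia.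
have kE : (2 * k - 1)%:R = 2 * k%:R - 1 :> R by rewrite natrB ?natrM //; lia.
(* Relative to [wt f], the gaps add at most [(2 * k - 1) * g] along the sequence and [2 * k * g] at
   the closing; by [g_le] the slack [(2 * k - 1) * eps] covers both. *)
have cost : (size s)%:R * ((1 + g) * wt f) + c <= (2 * k - 1)%:R * (1 + eps) * wt f.
  have g_le' := g_le; have := c_le f fzs; rewrite kE in g_le' size_le * => c_le_f.
  have : (size s)%:R * ((1 + g) * wt f) <= (2 * k%:R - 1) * ((1 + g) * wt f).
    by rewrite ler_wpM2r // mulr_ge0 ?addr_ge0 // ltW.
  have : 4 * k%:R * g * wt f <= (2 * k%:R - 1) * eps * wt f.
    by rewrite ler_wpM2r // ltW.
  have : 0 <= g * wt f by rewrite mulr_ge0 // ltW.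
  lra.
move=> /(reach_le cost); rewrite /head /tail.
case: (f.2) => [/(reach_sym w_sym)|]; exact: (greedy (origA f.1)).
Qed.

(** A cycle with distinct originals is itself a short closed sequence. Otherwise an innermost
    repetition of an original is cut out: in equal directions the part from [x] to just before [y]
    closes up, in opposite directions the part strictly between them. *)
Lemma copies_girth c :
  cycle (nonbacktracking a b) c -> (size c <= 2 * k)%N -> c = [::].
Proof.
case: c => // z s cyc size_zs; exfalso.
have linked_nb : subrel (nonbacktracking a b) linked by move=> d d' /andP[].
have wt_ge0 d : 0 <= wt d by rewrite ltW // A_gt0.
have k1 : 1 <= 2 * k%:R :> R by rewrite -natrM ler1n; lia.
have max_le d d' d'' : g * Num.max (wt d) (wt d') <= g * k%:R * wt d''.
  by rewrite maxr_pMr // ge_max !ratio.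
have loose d d' d'' : g * Num.max (wt d) (wt d') <= 2 * k%:R * g * wt d''.
  have := max_le d d' d''; have : 0 <= g * k%:R * wt d'' by rewrite !mulr_ge0.
  lra.
have [zs_uniq|] := boolP (uniq (map (fun d : dart => orig d.1) (z :: s))).
  move: cyc; rewrite /= rcons_path => /andP[/(sub_path linked_nb) zs /linked_nb sz].
  apply: (no_short_closed_sequence zs _ zs_uniq (gap_linked sz)) => // d _.
case/nonuniq_split=> s1 [x [p [y [s2 [def_zs orig_xy p_uniq]]]]].
have xpy : path (nonbacktracking a b) x (rcons p y).
  have : sorted (nonbacktracking a b) (z :: s) by move: cyc; rewrite /= rcons_path => /andP[].
  by rewrite def_zs => /cat_sorted2[_] /=; rewrite -cat_rcons cat_path => /andP[].
have size_p : (size p < 2 * k)%N.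
  by move: size_zs; rewrite def_zs size_cat /= size_cat /=; lia.
move: xpy; rewrite rcons_path => /andP[xp py].
have [eq_o|neq_o] := eqVneq x.2 y.2.
  have tail_xy : tail x = tail y by rewrite /tail eq_o orig_xy.
  have closing := gap_linked (linked_nb _ _ py); rewrite -tail_xy in closing.
  by apply: (no_short_closed_sequence (sub_path linked_nb xp) _ p_uniq closing).
have opp : ~~ x.2 = y.2 by move: neq_o; case: (x.2); case: (y.2).
(* An empty [p] would make [y] the reverse of [x]. *)
case: p => [|z' p] in def_zs p_uniq size_p xp py *.
  move: py => /= /andP[/eqP xy /eqP[]]; apply/esym/copies => //.
  by rewrite /src dart_src_inv.
move: xp => /= /andP[xz zp]; move: p_uniq => /= /andP[_ p_uniq].
(* Two gaps meeting at [tail y], which is [head x], close the inner part. By [ratio] each is at most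
   [g * k] times any weight, hence the factor 2 in the budget. *)
apply: (no_short_closed_sequence (sub_path linked_nb zp) _ p_uniq).
- by rewrite ltnW.
- apply: reach_trans (gap_linked (linked_nb _ _ py)) _.
  have -> : tail y = head x by rewrite /tail /head -orig_xy -opp; case: (x.2).
  exact: gap_linked (linked_nb _ _ xz).
- move=> d _; have := max_le (last z' p) y d; have := max_le x z' d; lra.
Qed.
End Girth.

(** [D] is one more than the integer part of [y], the [k]-th root of the number of vertices: then
    [D ^ k] exceeds that number, while [D <= 2 * y] because [y >= 1]. *)
Lemma moore_bound_powR (R : realType) (I V : finType) (a b : I -> V) k : (0 < k)%N ->
  (forall c, cycle (nonbacktracking a b) c -> (size c <= 2 * k)%N -> c = [::]) ->
  #|I|%:R <= 2 * #|V|%:R `^ (1 + k%:R^-1) :> R.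
Proof.
move=> k_gt0 girth; have [V0|V_gt0] := posnP #|V|.
  suff -> : #|I| = 0 by rewrite mulr_ge0 ?powR_ge0.
  by apply: eq_card0 => i; move/card0_eq: V0 => /(_ (a i)).
pose N : R := #|V|%:R; pose y := N `^ k%:R^-1.
have N1 : 1 <= N by rewrite ler1n.
have y1 : 1 <= y by rewrite -(powRr0 N) ler_powR // invr_ge0.
pose D := (Num.trunc y).+1.
have yD : y < D%:R by exact: truncnS_gt.
have Dy : D%:R <= 2 * y.
  by rewrite /D -natr1 mulr_natl mulr2n lerD // truncn_le (le_trans ler01).
have yk : y ^+ k = N.
  rewrite -powR_mulrn ?powR_ge0 // -powRrM mulVf ?pnatr_eq0 -?lt0n //.
  by rewrite powRr1 // (le_trans ler01).
have : (#|V| < D ^ k)%N.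
  rewrite -(ltr_nat R) natrX -/N -yk ltrXn2r -?lt0n //.
  exact: le_trans y1.
move=> /(moore_bound girth); rewrite -(ler_nat R) natrM => /le_trans; apply.
rewrite powRD ?powRr1 // -/N -/y; last by rewrite gt_eqF // (lt_le_trans ltr01).
by rewrite (mulrC N) mulrA ler_wpM2r.
Qed.

(** * Number and weight of the greedy edges *)

Section Lightness.

Variables (R : realType) (n : nat) (w : 'I_n -> 'I_n -> R).
Hypothesis w_sym : forall u v, w u v = w v u.
Variables (X A : {set 'I_n * 'I_n}) (rank : 'I_n * 'I_n -> nat) (k : nat) (eps : R).
Hypothesis k_gt1 : (1 < k)%N.
Hypothesis eps_gt0 : 0 < eps.
Hypothesis A_gt0 : {in A, forall e, 0 < ew w e}.
Hypothesis rank_inj : {in A &, injective rank}.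
Hypothesis rank_mono : {in A &, forall e f, (rank e < rank f)%N -> ew w e <= ew w f}.
Hypothesis greedy : {in A, forall f,
  ~ reach w (X :|: [set e in A | (rank e < rank f)%N]) f.1 f.2
      ((2 * k - 1)%:R * (1 + eps) * ew w f)}.

Let k_gt0 : (0 < k)%N. Proof. exact: ltnW. Qed.
Let kE : (2 * k - 1)%:R = 2 * k%:R - 1 :> R. Proof. by rewrite natrB ?natrM //; lia. Qed.
Let kR : 2 <= k%:R :> R. Proof. by rewrite ler_nat. Qed.

(** Every edge is its own single copy and [g = 0]: consecutive darts meet exactly, without gaps. *)
Lemma greedy_sparse : #|A|%:R <= 2 * n%:R `^ (1 + k%:R^-1) :> R.
Proof.
pose I := {e : 'I_n * 'I_n | e \in A}.
pose a (i : I) := (val i).1; pose b (i : I) := (val i).2.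
have -> : #|A| = #|{: I}| by rewrite card_sig; apply: eq_card.
suff girth c : cycle (nonbacktracking a b) c -> (size c <= 2 * k)%N -> c = [::].
  by have := moore_bound_powR R k_gt0 girth; rewrite card_ord.
apply: (@copies_girth R n w w_sym X A rank k eps k_gt0 A_gt0 rank_inj rank_mono
  greedy I 'I_n val a b 0) => //.
- exact: valP.
- by rewrite mulr0 mulr_ge0 // ltW.
- by move=> d d'; rewrite /dart_src /a /b => ->; apply: reach_refl; rewrite mul0r.
- by move=> d d'; rewrite !mul0r.
- by move=> [i o] [i' o'] _ /= /val_inj -> ->.
Qed.

Variables (pos : 'I_n -> R) (L : R).
Hypothesis L_ge0 : 0 <= L.
Hypothesis posL : forall u, 0 <= pos u <= L.
Hypothesis pos_reach : forall u v, reach w X u v `|pos u - pos v|.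

Let dist_le u v : `|pos u - pos v| <= L.
Proof. by have := posL u; have := posL v; rewrite ler_norml; lra. Qed.

(** Any two vertices are within [L] of each other in [X], so a heavier edge would already be spanned
    when examined. *)
Lemma stretch_lt e : e \in A -> (2 * k - 1)%:R * (1 + eps) * ew w e < L.
Proof.
move=> eA; rewrite ltNge; apply/negP=> le_L; apply: (greedy eA).
apply: reach_sub (finset.subsetUl _ _) _.
by apply: reach_le (pos_reach e.1 e.2); apply: le_trans le_L.
Qed.

Lemma edge_lt e : e \in A -> ew w e < L /\ 3 * eps * ew w e < L.
Proof.
move=> eA; have := stretch_lt eA; rewrite kE.
have w0 := A_gt0 eA.
have : 0 <= (k%:R - 2) * (eps * ew w e) by rewrite !mulr_ge0 ?subr_ge0 // ltW.
have : 0 <= (k%:R - 2) * ew w e by rewrite !mulr_ge0 ?subr_ge0 // ltW.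
have : 0 < eps * ew w e by rewrite mulr_gt0.
by move=> *; split; lra.
Qed.

(** The count is the integer part [m] of [y / x]. It lies between [1] and [k - 1], so indices in
    ['I_k] suffice, and [y / x < m + 1 <= 2 * m]. *)
Lemma card_trunc_copies (x y : R) : 0 < x -> x <= y -> y < k%:R * x ->
  y <= 2 * x * #|[set i : 'I_k | i.+1%:R * x <= y]|%:R.
Proof.
move=> x0 xy yk; pose m := Num.trunc (y / x).
have y0 : 0 <= y / x by rewrite divr_ge0 // ltW // (lt_le_trans x0).
have m_gt0 : (0 < m)%N by rewrite truncn_gt0 ler_pdivlMr // mul1r.
have m_lt : (m < k)%N by rewrite truncn_lt_nat // ltr_pdivrMr.
have -> : #|[set i : 'I_k | i.+1%:R * x <= y]| = m.
  have inj : injective (widen_ord (ltnW m_lt)) by move=> i j [] /val_inj.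
  rewrite -[RHS]card_ord -(card_imset _ inj).
  apply: eq_card => i; rewrite !inE -ler_pdivlMr // -truncn_gt_nat -/m.
  apply/idP/imsetP => [lt_im|[j _ ->]]; last exact: (ltn_ord j).
  by exists (Ordinal lt_im) => //; apply: val_inj.
have : y / x < m.+1%:R by exact: truncnS_gt.
rewrite ltr_pdivrMr // -natr1 => /ltW/le_trans; apply.
have : 1 <= m%:R :> R by rewrite ler1n.
move=> m1; have : 0 <= (m%:R - 1) * x by rewrite mulr_ge0 ?subr_ge0 // ltW.
lra.
Qed.

(** The number of copies of an edge is proportional to its weight, so bounding the copies bounds the
    weight. The constant is [2 * 2 * 36]: rounding the number of copies, the factor in the Moore
    bound, and [6 ^ (1 + 1/k) <= 36] for at most [6 * Q] cells. *)
Lemma scale_weight (x : R) : 0 < x ->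
  \sum_(e in A | x <= ew w e < k%:R * x) ew w e <=
  144 * L * (L / x) `^ k%:R^-1 / eps `^ (1 + k%:R^-1).
Proof.
move=> x0; pose B := [set e in A | x <= ew w e < k%:R * x].
have [B0|[e0]] := set_0Vmem B.
  rewrite big_pred0 ?divr_ge0 ?mulr_ge0 ?powR_ge0 // => e.
  by move/finset.setP/(_ e): B0; rewrite !inE.
rewrite inE => /and3P[e0A xe0 _].
pose Q := L / (eps * x).
have ex0 : 0 < eps * x by rewrite mulr_gt0.
have Q1 : 1 <= Q.
  rewrite ler_pdivlMr // mul1r; have [_] := edge_lt e0A.
  by have := ler_wpM2l (ltW eps_gt0) xe0; lra.
pose dlt := eps * x / 4; have dlt0 : 0 < dlt by rewrite divr_gt0.
(* Unshifted cell numbers are at most [4 * Q], and an edge of weight below [L / (3 * eps)] is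
   shifted by fewer than [Q] cells. *)
pose N := (Num.trunc (4 * Q) + Num.trunc Q)%N.
pose P (p : 'I_n * 'I_n * 'I_k) := (p.1 \in B) && (p.2.+1%:R * x <= ew w p.1).
pose I := {p | P p}.
pose cl u (i : nat) := (Num.trunc (pos u / dlt) + i)%N.
pose a (p : I) : 'I_N.+1 := inord (cl (val p).1.1 (val p).2).
pose b (p : I) : 'I_N.+1 := inord (cl (val p).1.2 (val p).2).
have IP (p : I) : [/\ (val p).1 \in A, x <= ew w (val p).1 < k%:R * x &
    (val p).2.+1%:R * x <= ew w (val p).1].
  by have /andP[] := valP p; rewrite inE => /andP[].
have clN u (p : I) : (cl u (val p).2 <= N)%N.
  have [pA _ le_p] := IP p; apply: leq_add.
    apply: le_truncn; rewrite ler_pdivrMr // /Q /dlt.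
    rewrite [leRHS](_ : _ = L); first by case/andP: (posL u).
    by field; rewrite !gt_eqF.
  rewrite truncn_ge_nat ?(le_trans ler01) // ler_pdivlMr //.
  have [_] := edge_lt pA; have := ler_wpM2l (ltW eps_gt0) le_p.
  have epsw : 0 <= eps * ew w (val p).1 by rewrite mulr_ge0 // ltW // A_gt0.
  by rewrite -natr1; lra.
have clE (d : I * bool) : dart_src a b d =
    cl (if d.2 then (val d.1).1.1 else (val d.1).1.2) (val d.1).2 :> nat.
  by case: d => p []; rewrite /dart_src /= inordK // ltnS clN.
(* The unshifted cells differ by [j - i <= j], and one more length accounts for the positions inside
   the cells. As [j.+1 * x] is at most the weight of the edge shifted by [j], this gives the gap
   condition with [g = eps / 4]. *)
have pos_cl u v i j : cl u i = cl v j -> (i <= j)%N -> `|pos u - pos v| <= j.+1%:R * dlt.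
  rewrite /cl => cl_eq le_ij; have dlt_ge0 := ltW dlt0.
  have itv z : let y := (Num.trunc (pos z / dlt))%:R in
      y * dlt <= pos z /\ pos z < (y + 1) * dlt.
    have /truncn_itv : 0 <= pos z / dlt by rewrite divr_ge0 //; case/andP: (posL z).
    by rewrite -natr1 ler_pdivlMr // ltr_pdivrMr // => /andP[].
  have [lu uu] := itv u; have [lv uv] := itv v.
  have cl_eqR := congr1 (fun m => m%:R * dlt) cl_eq.
  rewrite !natrD !mulrDl in cl_eqR.
  have i0 : 0 <= i%:R * dlt by rewrite mulr_ge0.
  have ij : i%:R * dlt <= j%:R * dlt by rewrite ler_wpM2r // ler_nat.
  by rewrite ler_norml -natr1; lra.
have girth c : cycle (nonbacktracking a b) c -> (size c <= 2 * k)%N -> c = [::].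
  apply: (@copies_girth R n w w_sym X A rank k eps k_gt0 A_gt0 rank_inj rank_mono
    greedy I 'I_N.+1 (fun p => (val p).1) a b (eps / 4)) => //.
  - by move=> p; have [] := IP p.
  - by rewrite divr_ge0 // ltW.
  - rewrite kE; have : 0 <= (k%:R - 2) * eps by rewrite mulr_ge0 ?subr_ge0 // ltW.
    by have := eps_gt0; lra.
  - move=> d d' /(congr1 (@nat_of_ord _)); rewrite !clE => cl_eq.
    have [_ _ le_d] := IP d.1; have [_ _ le_d'] := IP d'.1.
    apply: reach_le (pos_reach _ _).
    have bnd (p : 'I_n * 'I_n * 'I_k) :
        p.2.+1%:R * x <= ew w p.1 -> p.2.+1%:R * dlt <= eps / 4 * ew w p.1.
      move=> H; have := ler_wpM2l (ltW eps_gt0) H; rewrite /dlt; lra.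
    have e4 : 0 <= eps / 4 by rewrite divr_ge0 // ltW.
    rewrite maxr_pMr // le_max.
    case/orP: (leq_total (val d.1).2 (val d'.1).2) => [/(pos_cl _ _ _ _ cl_eq)|].
      by move=> H; apply/orP; right; apply: le_trans H _; apply: bnd.
    rewrite distrC => /(pos_cl _ _ _ _ (esym cl_eq)) H.
    by apply/orP; left; apply: le_trans H _; apply: bnd.
  - move=> d d'; have [_ /andP[_ ub] _] := IP d.1; have [_ /andP[lb _] _] := IP d'.1.
    rewrite -(mulrA (eps / 4)) ler_wpM2l ?divr_ge0 ?(ltW eps_gt0) //.
    by apply: le_trans (ltW ub) _; rewrite ler_wpM2l.
  (* For one edge in one direction, the cell determines the shift. *)
  - move=> [p o] [p' o'] /(congr1 (@nat_of_ord _)); rewrite !clE /= => cl_eq p1 oo.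
    congr (_, _) => //; apply: val_inj; rewrite [LHS]surjective_pairing [RHS]surjective_pairing.
    congr (_, _) => //; apply: val_inj; move: cl_eq; rewrite /cl p1 oo.
    exact: addnI.
have cardI : #|{: I}| = (\sum_(e in B) #|[set i : 'I_k | (i.+1%:R * x <= ew w e)%R]|)%N.
  rewrite card_sig -sum1_card; under [RHS]eq_bigr do rewrite -sum1_card.
  rewrite pair_big_dep /=; apply: eq_bigl => p.
  by rewrite !inE /P !inE.
have NQ : N.+1%:R <= 6 * Q.
  rewrite -natr1 natrD; have : (Num.trunc (4 * Q))%:R <= 4 * Q by rewrite truncn_le; lra.
  have : (Num.trunc Q)%:R <= Q by rewrite truncn_le; lra.
  lra.
have Q0 : 0 < Q by apply: lt_le_trans Q1.
have cardI_le : #|{: I}|%:R <= 72 * Q `^ (1 + k%:R^-1).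
  have := moore_bound_powR R k_gt0 girth; rewrite card_ord => /le_trans; apply.
  have le_pow : N.+1%:R `^ (1 + k%:R^-1) <= (6 * Q) `^ (1 + k%:R^-1).
    have Q6 : 0 <= 6 * Q by lra.
    by apply: ge0_ler_powR NQ; rewrite ?nnegrE ?addr_ge0 ?invr_ge0.
  have le6 : 6 `^ (1 + k%:R^-1) <= 36 :> R.
    have -> : (36 : R) = 6 `^ 2%:R by rewrite powR_mulrn //; ring.
    by rewrite ler_powR ?ler1n // -natr1 addrC lerD2r invf_le1 ?ler1n // ltr0n.
  rewrite powRM ?(ltW Q0) // in le_pow.
  by have := ler_wpM2r (powR_ge0 Q (1 + k%:R^-1)) le6; lra.
have QE : x * Q `^ (1 + k%:R^-1) = L * (L / x) `^ k%:R^-1 / eps `^ (1 + k%:R^-1).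
  have powS y : 0 < y -> y `^ (1 + k%:R^-1) = y * y `^ k%:R^-1.
    by move=> y0; rewrite powRD ?powRr1 ?(ltW y0) // gt_eqF // implybT.
  have Qeps : Q * eps = L / x by rewrite /Q; field; rewrite !gt_eqF.
  rewrite !powS // -Qeps powRM ?(ltW Q0) ?(ltW eps_gt0) //.
  have -> : L = Q * eps * x by rewrite Qeps; field; rewrite gt_eqF.
  by field; rewrite !gt_eqF ?powR_gt0.
rewrite (@le_trans _ _ (2 * x * #|{: I}|%:R)) //.
  rewrite cardI natr_sum mulr_sumr (eq_bigl (fun e => e \in B)); last by move=> e; rewrite inE.
  apply: ler_sum => e; rewrite inE => /and3P[_ lb ub]; exact: card_trunc_copies.
rewrite -(mulrA 144 L) -(mulrA 144) -QE.
have := ler_wpM2l (ltW x0) cardI_le; lra.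
Qed.

(** The ratio is [q = expR (- y)] with [y = ln k / k] in []0, 1]], and [1 + y <= expR y] gives
    [1 - q >= y / (1 + y) >= y / 2]. *)
Lemma geometric_scales m :
  \sum_(i < m) (k%:R^-1 `^ k%:R^-1) ^+ i <= 2 * (k%:R / ln k%:R) :> R.
Proof.
have k_pos : 0 < k%:R :> R by rewrite ltr0n.
have lnk : 0 < ln k%:R :> R by rewrite ln_gt0 // ltr1n.
set q := _ `^ _; pose y : R := ln k%:R / k%:R.
have y0 : 0 < y by rewrite divr_gt0.
have y1 : y <= 1 by rewrite ler_pdivrMr // mul1r ltW // ln_sublinear.
have qE : q = (expR y)^-1.
  by rewrite /q /powR invr_eq0 gt_eqF // lnV ?posrE // mulrN mulrC expRN.
have q_gt0 : 0 < q by rewrite qE invr_gt0 expR_gt0.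
have q_lt : y / 2 <= 1 - q.
  have : q * (1 + y) <= 1.
    by rewrite -ler_pdivlMr ?addr_gt0 // qE mul1r lef_pV2 ?posrE ?expR_gt0 ?addr_gt0 ?expR_ge1Dx.
  move=> qy; have := mulr_ge0 (ltW y0) (ltW q_gt0).
  nra.
have geo : (1 - q) * \sum_(i < m) q ^+ i <= 1.
  by rewrite -opprB mulNr -subrX1 opprB gerBl exprn_ge0 // ltW.
have -> : 2 * (k%:R / ln k%:R) = (y / 2)^-1.
  by rewrite /y; field; rewrite !gt_eqF.
rewrite -[_^-1]mul1r ler_pdivlMr ?divr_gt0 // mulrC; apply: le_trans geo.
by rewrite ler_wpM2r // sumr_ge0 // => i _; rewrite exprn_ge0 // ltW.
Qed.

Lemma scale_exists (x y : R) m : x <= y -> y < k%:R ^+ m * x ->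
  exists i : 'I_m, k%:R ^+ i * x <= y < k%:R * (k%:R ^+ i * x).
Proof.
move=> xy; elim: m => [|m IHm]; first by rewrite mul1r ltNge xy.
rewrite exprS -mulrA => y_lt; have [/IHm[i iy]|y_ge] := ltP y (k%:R ^+ m * x).
  by exists (widen_ord (leqnSn m) i).
by exists ord_max; rewrite //= y_ge.
Qed.

(** Edges below [L / n] are controlled by their number, which contributes the [2]; the others lie in
    [n] scales whose bounds are summed geometrically, with [288 = 144 * 2]. *)
Lemma greedy_weight : (0 < n)%N ->
  \sum_(e in A) ew w e <=
  L * n%:R `^ k%:R^-1 * (2 + 288 * (k%:R / (eps `^ (1 + k%:R^-1) * ln k%:R))).
Proof.
move=> n_gt0; have nR : 0 < n%:R :> R by rewrite ltr0n.
have lnk : 0 < ln k%:R :> R by rewrite ln_gt0 // ltr1n.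
have rhs_ge0 : 0 <= L * n%:R `^ k%:R^-1 *
    (2 + 288 * (k%:R / (eps `^ (1 + k%:R^-1) * ln k%:R))).
  apply: mulr_ge0; first by rewrite mulr_ge0 ?powR_ge0.
  rewrite addr_ge0 ?ler0n // mulr_ge0 ?ler0n // divr_ge0 ?ler0n // mulr_ge0 ?powR_ge0 //.
  exact: ltW.
have [A0|[e0 e0A]] := set_0Vmem A; first by rewrite A0 big_set0.
have L_gt0 : 0 < L by have [lt_L _] := edge_lt e0A; apply: lt_trans (A_gt0 e0A) lt_L.
pose x i := k%:R ^+ i * (L / n%:R).
have x_gt0 i : 0 < x i by rewrite mulr_gt0 ?divr_gt0 // exprn_gt0 // ltr0n.
have split_e e : e \in A ->
    ew w e <= L / n%:R + \sum_(i < n | x i <= ew w e < k%:R * x i) ew w e.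
  move=> eA; have w0 := A_gt0 eA; have [light|heavy] := ltP (ew w e) (L / n%:R).
    by apply: ler_wpDr (ltW light); apply: sumr_ge0 => *; apply: ltW.
  (* [n] scales suffice: all weights are below [L], and [n <= k ^ n]. *)
  have [|i ie] := scale_exists heavy (m := n).
    have [/lt_le_trans + _] := edge_lt eA; apply.
    rewrite mulrA ler_pdivlMr // mulrC ler_wpM2r // -natrX ler_nat.
    by rewrite ltnW // ltn_expl.
  rewrite (bigD1 i) //= ler_wpDl ?divr_ge0 ?ler0n // ler_wpDr // sumr_ge0 // => *.
  exact: ltW.
apply: le_trans (ler_sum _ split_e) _; rewrite big_split /=.
rewrite (exchange_big_dep predT) //= sumr_const -[_ *+ _]mulr_natr.
have light_part : L / n%:R * #|A|%:R <= L * n%:R `^ k%:R^-1 * 2.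
  have -> : L * n%:R `^ k%:R^-1 * 2 = L / n%:R * (2 * n%:R `^ (1 + k%:R^-1)).
    rewrite powRD ?powRr1 // ?gt_eqF ?implybT //.
    by field; rewrite gt_eqF.
  by rewrite ler_wpM2l ?greedy_sparse // divr_ge0.
have scale i : \sum_(e in A | x i <= ew w e < k%:R * x i) ew w e <=
    144 * L * n%:R `^ k%:R^-1 / eps `^ (1 + k%:R^-1) * (k%:R^-1 `^ k%:R^-1) ^+ i.
  apply: le_trans (scale_weight (x_gt0 i)) _.
  have -> : L / x i = n%:R * k%:R^-1 ^+ i.
    rewrite /x exprVn; field; rewrite !gt_eqF // exprn_gt0 // ltr0n //.
  rewrite powRM ?exprn_ge0 ?invr_ge0 // -powR_mulrn ?invr_ge0 // powRAC powR_mulrn ?powR_ge0 //.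
  by rewrite le_eqVlt; apply/predU1P; left; ring.
rewrite mulrDr; apply: lerD => //.
apply: le_trans; first by apply: ler_sum => i _; apply: scale.
rewrite -mulr_sumr; apply: le_trans (ler_wpM2l _ (geometric_scales n)) _.
  by rewrite divr_ge0 ?mulr_ge0 ?powR_ge0.
rewrite le_eqVlt; apply/predU1P; left; field; rewrite !gt_eqF // powR_gt0 //.
Qed.
End Lightness.

(** * Assembling the spanner *)

Lemma symg_upper n (E : graph n) : gundirected E -> symg (upper E) = E.
Proof.
move=> [E_sym E_irr]; apply/finset.setP=> -[u v]; rewrite !inE /= (E_sym v u) -andb_orr.
case: ltngtP => [||/val_inj eq_uv]; rewrite ?andbT // andbF.
by rewrite eq_uv; apply/esym/negbTE.
Qed.

(** It suffices to span single edges, since a walk is replaced edge by edge. Moving [t] to the other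
    side lets the infimum be bounded walk by walk. *)
Lemma gdist_spanner (R : realType) n (E : graph n) (w : 'I_n -> 'I_n -> R)
    (X : {set 'I_n * 'I_n}) (t : R) : 0 < t ->
  (forall u v, (u, v) \in E -> reach w X u v (t * w u v)) ->
  forall u v, (gdist (symg X) w u v <= t%:E * gdist E w u v)%E.
Proof.
move=> t_gt0 spanE u v; rewrite -lee_pdivrMl //; apply: le_ereal_inf_tmp.
move=> _ [p /andP[up /eqP pv] <-]; rewrite lee_pdivrMl // -EFinM.
have [q [uq qv le_q]] : reach w X u v (t * walk_weight w u p).
  rewrite -{}pv; elim: p u up => [|x p IHp] u /=.
    by move=> _; apply: reach_refl; rewrite walk_weight_nil mulr0.
  move=> /andP[ux xp]; rewrite walk_weight_cons mulrDr.
  exact: reach_trans (spanE _ _ ux) (IHp _ xp).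
apply: ereal_inf_le; exists (walk_weight w u q)%:E; last by rewrite lee_fin.
by exists q => //=; rewrite uq qv eqxx.
Qed.

Theorem theorem1 (R : realType) :
  exists C1 C2 : R, 0 < C1 /\ 0 < C2 /\
  forall (n : nat) (E : graph n) (w : 'I_n -> 'I_n -> R) (k : nat) (eps : R),
    gundirected E -> gconnected E ->
    (forall u v, w u v = w v u) ->
    (forall u v, (u, v) \in E -> 0 < w u v) ->
    (2 <= k)%N -> 0 < eps ->
    exists H : graph n,
      is_spanner E H w ((2 * k - 1)%:R * (1 + eps)) /\
      (num_edges H)%:R <= C1 * n%:R `^ (1 + k%:R^-1) /\
      forall T, is_MST E w T ->
        gweight w H <=
          C2 * n%:R `^ (k%:R^-1) *
          (1 + k%:R / (eps `^ (1 + k%:R^-1) * ln k%:R)) * gweight w T.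
Proof.
(* The tree contributes [1] and the added edges [2] to the first constant; [576 = 2 * 288] as [L] is
   twice the tree weight, with room for the tree itself and the light edges. *)
exists 3%:R, 576%:R; rewrite !ltr0n; split=> //; split=> //.
move=> n E w k eps E_und E_conn w_sym w_gt0 k_gt1 eps_gt0.
set t := _ * (1 + eps).
have t_ge1 : 1 <= t.
  have k1 : 1 <= (2 * k - 1)%:R :> R by rewrite ler1n; lia.
  by rewrite /t mulrDr mulr1 ler_wpDr // mulr_ge0 // ltW.
have t_gt0 : 0 < t by apply: lt_le_trans t_ge1.
case: n => [|n] in E w E_und E_conn w_sym w_gt0 *.
  exists E; split; first by split=> //; split=> // -[].
  split=> [|T _]; first by rewrite /num_edges eq_card0 ?mulr_ge0 ?powR_ge0 // => -[[]].
  by rewrite /gweight !big1 ?mulr0 // => -[[]].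
(* [G] is a minimum spanning tree if there is one, and otherwise [E], for which the last clause
   holds vacuously. *)
have [G [sGE G_und G_conn G_min]] : exists G : graph n.+1,
    [/\ G \subset E, gundirected G, gconnected G &
    forall T, is_MST E w T -> gweight w G <= gweight w T].
  have [[T [T_tree T_min]]|no] := pselect (exists T, is_MST E w T).
    have [sTE [T_und [T_conn _]]] := T_tree.
    by exists T; split=> // T' [/T_min].
  by exists E; split=> // T T_mst; case: no; exists T.
have w_ge0 u v : (u, v) \in G -> 0 <= w u v.
  by move=> /(fintype.subsetP sGE) uvE; apply/ltW/w_gt0.
have [X [pos [sXG X_card pos_reach posL]]] := tree_line w_sym (ltn0Sn n) G_und G_conn w_ge0.
set L := 2 * _ in posL.
have sXE : X \subset upper E.
  apply: fintype.subset_trans sXG _; apply/fintype.subsetP=> e; rewrite !inE => /andP[eG ->].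
  by rewrite (fintype.subsetP sGE).
have upper_gt0 e : e \in upper E -> 0 < ew w e.
  by rewrite inE => /andP[]; case: e => u v /w_gt0.
pose leE e f := ew w e <= ew w f.
have leE_total : total leE by move=> e f; apply: le_total.
have leE_trans : transitive leE by move=> e f h; apply: le_trans.
pose s := sort leE (enum (upper E :\: X)).
have s_mem e : (e \in s) = (e \in upper E :\: X) by rewrite mem_sort mem_enum.
have [||A [sAs A_greedy A_span]] := @greedy_exists R n.+1 w X t s.
- by rewrite sort_uniq enum_uniq.
- move=> e; rewrite s_mem inE => /andP[_ /upper_gt0 e0].
  by rewrite ler_peMl // ltW.
have sAE e : e \in A -> e \in upper E by move=> /sAs; rewrite s_mem inE => /andP[].
have A_gt0 : {in A, forall e, 0 < ew w e} by move=> e /sAE/upper_gt0.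
pose rank e := index e s.
have rank_inj : {in A &, injective rank}.
  by move=> e f /sAs es /sAs fs; apply: index_inj.
have rank_mono : {in A &, forall e f, (rank e < rank f)%N -> ew w e <= ew w f}.
  move=> e f /sAs es /sAs fs.
  exact: (sorted_ltn_index leE_trans (sort_sorted leE_total _)).
have L_ge0 : 0 <= L.
  by rewrite mulr_ge0 // sumr_ge0 // => e /(fintype.subsetP sXE)/upper_gt0/ltW.
have A_sparse := greedy_sparse w_sym k_gt1 eps_gt0 A_gt0 rank_inj rank_mono A_greedy.
have A_light := greedy_weight w_sym k_gt1 eps_gt0 A_gt0 rank_inj rank_mono A_greedy
  L_ge0 posL pos_reach (ltn0Sn n).
have XA_lt e : e \in X :|: A -> (e.1 < e.2)%N.
  by rewrite inE => /orP[/(fintype.subsetP sXE)|/sAE]; rewrite inE => /andP[].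
have dis : [disjoint X & A].
  rewrite disjoint_sym; apply/pred0P=> e /=; apply/negP=> /andP[/sAs].
  by rewrite s_mem inE => /andP[/negP].
exists (symg (X :|: A)); split; [split; [|split]|split].
- rewrite -(symg_upper E_und); apply/fintype.subsetP=> e.
  have sub : X :|: A \subset upper E.
    by rewrite finset.subUset sXE; apply/fintype.subsetP.
  by rewrite ![_ \in symg _]inE => /orP[] /(fintype.subsetP sub) ->; rewrite ?orbT.
- exact: gundirected_symg.
- apply: gdist_spanner => // u v.
  have span e : e \in upper E -> reach w (X :|: A) e.1 e.2 (t * ew w e).
    move=> eE; have [eX|eX] := boolP (e \in X); last first.
      by apply: A_span; rewrite s_mem inE eX.
    apply: (@reach_le _ _ _ _ _ _ (ew w e)); first by rewrite ler_peMl // ltW // upper_gt0.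
    by apply: reach_adj; rewrite /adj !inE -surjective_pairing eX.
  rewrite -{1}(symg_upper E_und) inE => /orP[/span //|/span /=].
  by rewrite /ew /= w_sym; apply: reach_sym.
- rewrite num_edges_symg // cardsU disjoint_setI0 // cards0 subn0 natrD.
  have n_le : n.+1%:R <= n.+1%:R `^ (1 + k%:R^-1) :> R.
    by rewrite le1r_powR ?ler1n // lerDl invr_ge0.
  have : #|X|%:R <= n.+1%:R :> R by rewrite ler_nat.
  lra.
- move=> T /G_min G_le; rewrite gweight_symg //.
  rewrite (eq_bigl [in [predU X & A]]) => [|e]; last by rewrite !inE.
  rewrite bigU //=; move: A_light; rewrite /L.
  set r := _ `^ _; set K := _ / _; set S := \sum_(e in X) _ => A_light.
  have S_ge0 : 0 <= S by apply: sumr_ge0 => e /(fintype.subsetP sXE)/upper_gt0/ltW.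
  have S_le : S <= gweight w T.
    apply: le_trans G_le; rewrite -(symg_upper G_und) gweight_symg; last first.
      by move=> e; rewrite inE => /andP[].
    rewrite (big_setID X) /= (finset.setIidPr sXG) ler_wpDr // sumr_ge0 // => e.
    rewrite !inE => /and3P[_ eG _]; move: eG; case: e => u v; exact: w_ge0.
  have r_ge1 : 1 <= r by rewrite -(powRr0 n.+1%:R) ler_powR ?ler1n // invr_ge0.
  have K_ge0 : 0 <= K.
    by rewrite divr_ge0 // mulr_ge0 ?powR_ge0 // ln_ge0 // ler1n ltnW.
  have rK : 0 <= r * (1 + K) by rewrite mulr_ge0 ?addr_ge0 // (le_trans ler01).
  rewrite (@le_trans _ _ (576 * r * (1 + K) * S)) //; last first.
    by apply: ler_wpM2l S_le; lra.
  have Sr : S <= r * S by rewrite ler_peMl.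
  have r_ge0 := le_trans ler01 r_ge1.
  have : 0 <= r * S * K by apply: mulr_ge0 K_ge0; apply: mulr_ge0.
  lra.
Qed.
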